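(* Let $P$ be any order of multiwavelet (MW) approximation, let $a>0$, and let $\bm{u}^P\in\mathbb{R}^P$ be the vector of MW coefficients of the velocity. For $\bm{S}^P\in\mathbb{R}^P$ let $\bm{f}^P=\bm{f}^P(\bm{S}^P)\in\mathbb{R}^P$ be the stochastic Galerkin flux defined by the linear system $$\left[\bm{B}(\bm{S}^P,\bm{S}^P)+a\,\bm{B}(\bm{e}_1-\bm{S}^P,\bm{e}_1-\bm{S}^P)\right]\bm{f}^P=\bm{B}(\bm{S}^P,\bm{S}^P)\,\bm{u}^P .$$ If the matrix $\bm{B}(\bm{S}^P,\bm{S}^P)+a\,\bm{B}(\bm{e}_1-\bm{S}^P,\bm{e}_1-\bm{S}^P)$ is positive definite, then the stochastic Galerkin formulation $$\frac{\partial \bm{S}^P}{\partial t}+\frac{\partial \bm{f}^P(\bm{S}^P)}{\partial x}=0$$ with this flux is hyperbolic, i.e. at every state $\bm{S}^P$ for which the positive definiteness assumption holds, the flux Jacobian $\partial\bm{f}^P/\partial\bm{S}^P\in\mathbb{R}^{P\times P}$ is diagonalizable with real eigenvalues.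
   Context: Let $(\Omega,\mathcal{F},\mathcal{P})$ be a probability space carrying a random vector $\boldsymbol{\xi}$, and write $\langle\cdot\rangle$ for the expectation with respect to the law of $\boldsymbol{\xi}$. The functions $\psi_1,\dots,\psi_P$ of $\boldsymbol{\xi}$ are the first $P$ (truncated) basis functions of a multiwavelet basis: real-valued bounded functions (piecewise polynomials on a bounded domain), orthonormal in the sense $\langle\psi_j\psi_k\rangle=\delta_{jk}$, with $\psi_1\equiv 1$. A random quantity $g(\boldsymbol{\xi})$ is approximated by $\sum_{k=1}^P g_k\psi_k(\boldsymbol{\xi})$ and identified with its coefficient vector $(g_1,\dots,g_P)^T\in\mathbb{R}^P$. The vectors $\bm{e}_1,\dots,\bm{e}_P$ are the standard basis vectors of $\mathbb{R}^P$; in particular $\bm{e}_1$ is the coefficient vector of the constant $1$. For $\bm{b},\bm{c}\in\mathbb{R}^P$, the $P\times P$ matrix $\bm{B}(\bm{b},\bm{c})$ is defined by $$[\bm{B}(\bm{b},\bm{c})]_{jk}=\sum_{h=1}^P\sum_{i=1}^P\langle\psi_h\psi_i\psi_j\psi_k\rangle\,b_h\,c_i,\qquad j,k=1,\dots,P.$$ The setting is the stochastic Galerkin version, in one space dimension $x$, of the Buckley-Leverett equation for the water saturation $S$, with fractional flow function $S^2/(S^2+a(1-S)^2)$ multiplied by the velocity, where $a$ is the (positive) viscosity ratio. The velocity vector $\bm{u}^P$ is given data not depending on $\bm{S}^P$, and $\bm{S}^P=(S_1,\dots,S_P)^T$ is the vector of MW coefficients of $S$. *)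

(* Defs.v *)
From HB Require Import structures.
From mathcomp Require Import all_boot all_order all_algebra.
From mathcomp Require Import all_classical all_reals all_analysis.

Set Implicit Arguments.
Unset Strict Implicit.
Unset Printing Implicit Defensive.

Import Order.TTheory GRing.Theory Num.Theory.
Import numFieldNormedType.Exports.

Local Open Scope classical_set_scope.
Local Open Scope ring_scope.

(* <g> = E[g(xi)], as a real number. *)
Definition mean (R : realType) (d : measure_display) (Omega : measurableType d)
    (Pr : probability Omega R) (N : nat) (xi : {RV Pr >-> N.-tuple R})
    (g : N.-tuple R -> R) : R :=
  fine 'E_Pr[g \o xi].

(* The properties of the first n.+1 multiwavelets, seen as functions of xi.
   A multiwavelet lives on the bounded domain where xi takes its values; it is
   extended to the whole space in any measurable way, so its bound and the
   identity psi_1 = 1 are only required on the values of xi.  The 1-based index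
   k of the multiwavelet psi_k is the ordinal k.-1. *)
Record multiwavelet_system (R : realType) (d : measure_display)
    (Omega : measurableType d) (Pr : probability Omega R) (N : nat)
    (xi : {RV Pr >-> N.-tuple R}) (n : nat)
    (psi : 'I_n.+1 -> N.-tuple R -> R) : Prop := MultiwaveletSystem {
  mw_measurable : forall k, measurable_fun [set: N.-tuple R] (psi k) ;
  mw_bounded : forall k, exists M : R, forall w, `|psi k (xi w)| <= M ;
  mw_orthonormal : forall j k,
    mean xi (fun y => psi j y * psi k y) = (j == k)%:R ;
  mw_first : forall w, psi ord0 (xi w) = 1 }.

Definition galerkinB (R : realType) (d : measure_display)
    (Omega : measurableType d) (Pr : probability Omega R) (N : nat)
    (xi : {RV Pr >-> N.-tuple R}) (n : nat)
    (psi : 'I_n.+1 -> N.-tuple R -> R) (b c : 'cV[R]_n.+1) : 'M[R]_n.+1 :=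
  \matrix_(j, k) \sum_(h < n.+1) \sum_(i < n.+1)
    mean xi (fun y => psi h y * psi i y * psi j y * psi k y) * b h 0 * c i 0.

Definition e1 (R : realType) (n : nat) : 'cV[R]_n.+1 := delta_mx ord0 0.

Definition buckley_leverett_matrix (R : realType) (d : measure_display)
    (Omega : measurableType d) (Pr : probability Omega R) (N : nat)
    (xi : {RV Pr >-> N.-tuple R}) (n : nat)
    (psi : 'I_n.+1 -> N.-tuple R -> R) (a : R) (S : 'cV[R]_n.+1) :
    'M[R]_n.+1 :=
  galerkinB xi psi S S
  + a *: galerkinB xi psi (e1 R n - S) (e1 R n - S).

(* f solves the linear system defining the flux at every state where the system
   has a unique solution; at the other states f is unconstrained. *)
Definition galerkin_flux (R : realType) (d : measure_display)
    (Omega : measurableType d) (Pr : probability Omega R) (N : nat)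
    (xi : {RV Pr >-> N.-tuple R}) (n : nat)
    (psi : 'I_n.+1 -> N.-tuple R -> R) (a : R) (u : 'cV[R]_n.+1)
    (f : 'cV[R]_n.+1 -> 'cV[R]_n.+1) : Prop :=
  forall S : 'cV[R]_n.+1,
    buckley_leverett_matrix xi psi a S \in unitmx ->
    buckley_leverett_matrix xi psi a S *m f S = galerkinB xi psi S S *m u.

Definition positive_definite (R : realType) (n : nat) (A : 'M[R]_n) : Prop :=
  A^T = A /\ forall v : 'cV[R]_n, v != 0 -> 0 < (v^T *m A *m v) 0 0.

(* Entry (j, k) is the partial derivative of f_j with respect to S_k. The
   library's ['J f S] acts on row vectors, hence is the transpose of this. *)
Definition flux_jacobian (R : realType) (n : nat)
    (f : 'cV[R]_n -> 'cV[R]_n) (S : 'cV[R]_n) : 'M[R]_n :=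
  \matrix_(j, k) 'D_(delta_mx k 0) (fun s : 'cV[R]_n => f s j 0) S.

(* Hyperbolicity at the state S of dS/dt + df(S)/dx = 0 in one space dimension.
   The Jacobian is diagonalized over the real field R itself, so that its
   eigenvalues are real. *)
Definition hyperbolic_at (R : realType) (n : nat)
    (f : 'cV[R]_n -> 'cV[R]_n) (S : 'cV[R]_n) : Prop :=
  differentiable f S /\ diagonalizable (flux_jacobian f S).

(* Main.v *)
Require Import Defs.
From HB Require Import structures.
From mathcomp Require Import all_boot all_order all_algebra.
From mathcomp Require Import all_classical all_reals all_analysis.
From mathcomp Require Import complex ring lra.

(** The tensor of fourth moments of the multiwavelets is invariant under every
    permutation of its four indices, because the product of functions is
    commutative.  Hence B is symmetric as a matrix and in its two arguments,
    and B(b, c) u = B(b, u) c: the vector that a Galerkin matrix acts on can be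
    exchanged with a coefficient vector that the matrix is built from.

    Let A(S) = B(S, S) + a B(e1 - S, e1 - S), so that A(S) f(S) = B(S, S) u.
    Differentiate this equation at S in a direction v.  Every term in which the
    derivative falls on a Galerkin matrix has v as an argument of B, and the
    exchange rule moves v out, to the place of the vector:
      A(S) Df(S) v = 2 (B(S, u) - B(S, f) + a B(e1 - S, f)) v.
    Thus the Jacobian J satisfies A J = G with G symmetric
    (galerkin_flux_jacobian).  Where A is positive definite, J = A^-1 G is
    self-adjoint for the inner product given by A^-1 on row vectors, and a
    matrix that is self-adjoint for an inner product is diagonalizable over the
    reals (selfadjoint_diagonalizable).

    Differentiability of f at S comes from Cramer's rule: the determinant of A
    is a polynomial in the state, so A stays invertible near S, and there
    f = (det A)^-1 adj(A) B(S, S) u is a rational function of the state. *)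

Set Implicit Arguments.
Unset Strict Implicit.

Import Order.TTheory GRing.Theory Num.Theory.
Import numFieldNormedType.Exports.

Local Open Scope classical_set_scope.
Local Open Scope ring_scope.

(** * Matrices that are self-adjoint for an inner product *)

Lemma positive_definite_row_ge0 (R : realType) (n : nat) (H : 'M[R]_n)
    (x : 'rV[R]_n) :
  positive_definite H -> 0 <= (x *m H *m x^T) 0 0.
Proof.
move=> [_ Hpos]; have [->|x0] := eqVneq x 0.
  by rewrite !mul0mx mxE.
by have := Hpos x^T; rewrite trmxK trmx_eq0 => /(_ x0)/ltW.
Qed.

Lemma positive_definite_row_eq0 (R : realType) (n : nat) (H : 'M[R]_n)
    (x : 'rV[R]_n) :
  positive_definite H -> (x *m H *m x^T) 0 0 = 0 -> x = 0.
Proof.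
move=> [_ Hpos] xHx; apply/eqP; apply: contraTT isT => x0.
by have := Hpos x^T; rewrite trmxK trmx_eq0 xHx ltxx => /(_ x0).
Qed.

Lemma positive_definite_unitmx (R : realType) (n : nat) (H : 'M[R]_n) :
  positive_definite H -> H \in unitmx.
Proof.
move=> Hpd; rewrite unitmxE unitfE; apply/det0P => -[v v0 vH].
case/eqP: v0; apply: positive_definite_row_eq0 Hpd _.
by rewrite vH mul0mx mxE.
Qed.

Lemma positive_definite_invmx (R : realType) (n : nat) (H : 'M[R]_n) :
  positive_definite H -> positive_definite (invmx H).
Proof.
move=> Hpd; have Hu := positive_definite_unitmx Hpd.
case: (Hpd) => Hsym Hpos; have HVsym : (invmx H)^T = invmx H.
  by rewrite trmx_inv Hsym.
split=> // v v0.
have /Hpos : invmx H *m v != 0.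
  by apply: contra_neq v0 => HVv; rewrite -(mulKVmx Hu v) HVv mulmx0.
by rewrite trmx_mul HVsym -!mulmxA (mulmxA H) mulmxV// mul1mx mulmxA.
Qed.

(** J H = H J^T says that J, acting on row vectors on the right, is self-adjoint
    for the form (x, y) |-> x H y^T.  This passes to the polynomials in J
    because they commute with J. *)
Lemma selfadjoint_horner (R : realType) (n : nat) (H J : 'M[R]_n.+1)
    (p : {poly R}) :
  J *m H = H *m J^T -> horner_mx J p *m H = H *m (horner_mx J p)^T.
Proof.
move=> JH; elim/poly_ind: p => [|p c IHp].
  by rewrite rmorph0 mul0mx trmx0 mulmx0.
rewrite rmorphD /= [in LHS]rmorphM /= [in RHS]mulrC [in RHS]rmorphM /=.
rewrite horner_mx_X horner_mx_C mulmxDl linearD mulmxDr /=.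
rewrite tr_scalar_mx scalar_mxC; congr (_ + _).
by rewrite -!mulmxE trmx_mul -mulmxA JH mulmxA IHp mulmxA.
Qed.

(** If M is self-adjoint, then the squared length of x M is the inner product of
    x M M with x. *)
Lemma selfadjoint_sqr_eq0 (R : realType) (n : nat) (H M : 'M[R]_n) :
  positive_definite H -> M *m H = H *m M^T -> M *m M = 0 -> M = 0.
Proof.
move=> Hpd MH MM; apply/row_matrixP => i; rewrite row0.
apply: (positive_definite_row_eq0 Hpd).
rewrite rowE trmx_mul mulmxA -(mulmxA _ M H) MH -MH.
rewrite -!mulmxA (mulmxA H) -MH -mulmxA (mulmxA M M) MM.
by rewrite !(mul0mx, mulmx0) mxE.
Qed.

(** Repeated use of the case of a square brings the exponents 2 ^ k down to 1;
    any other exponent is first raised to a power of two. *)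
Lemma selfadjoint_nilpotent_eq0 (R : realType) (n : nat) (H J : 'M[R]_n.+1)
    (p : {poly R}) (k : nat) :
  positive_definite H -> J *m H = H *m J^T ->
  horner_mx J (p ^+ k) = 0 -> horner_mx J p = 0.
Proof.
move=> Hpd JH pk0.
have {pk0} : horner_mx J (p ^+ (2 ^ k)) = 0.
  rewrite -(subnK (ltnW (ltn_expl k (ltnSn 1)))) exprD rmorphM /=.
  by rewrite pk0 mulr0.
elim: k => [|k IHk]; first by rewrite expr1.
rewrite expnSr exprM expr2 rmorphM /= => pp0; apply: IHk.
exact: (selfadjoint_sqr_eq0 Hpd (selfadjoint_horner _ JH)).
Qed.

(** Split a complex eigenvector into real row vectors, v = x + i y.  Comparing
    the inner product of x J and y with that of x and y J leaves
    Im z * (|x|^2 + |y|^2) = 0. *)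
Lemma selfadjoint_eigenvalue_real (R : realType) (n : nat) (H J : 'M[R]_n)
    (z : R[i]) :
  positive_definite H -> J *m H = H *m J^T ->
  eigenvalue (map_mx (real_complex R) J) z -> complex.Im z = 0.
Proof.
move=> Hpd JH /eigenvalueP[v vJ v0].
set x := map_mx (@complex.Re R) v; set y := map_mx (@complex.Im R) v.
have ReM (c d : R[i]) : complex.Re (c * d) =
    complex.Re c * complex.Re d - complex.Im c * complex.Im d.
  by case: c d => ? ? [].
have ImM (c d : R[i]) : complex.Im (c * d) =
    complex.Re c * complex.Im d + complex.Im c * complex.Re d.
  by case: c d => ? ? [].
have xJ : x *m J = complex.Re z *: x - complex.Im z *: y.
  transitivity (map_mx (@complex.Re R) (v *m map_mx (real_complex R) J)).
    apply/matrixP => i j; rewrite !mxE raddf_sum; apply: eq_bigr => k _ /=.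
    by rewrite !mxE ReM /= mulr0 subr0.
  by rewrite vJ; apply/matrixP => i j; rewrite !mxE ReM.
have yJ : y *m J = complex.Re z *: y + complex.Im z *: x.
  transitivity (map_mx (@complex.Im R) (v *m map_mx (real_complex R) J)).
    apply/matrixP => i j; rewrite !mxE raddf_sum; apply: eq_bigr => k _ /=.
    by rewrite !mxE ImM /= mulr0 add0r.
  by rewrite vJ; apply/matrixP => i j; rewrite !mxE ImM.
have : x *m J *m H *m y^T = x *m H *m (y *m J)^T.
  by rewrite trmx_mul -(mulmxA x) JH !mulmxA.
have yJT : (y *m J)^T = complex.Re z *: y^T + complex.Im z *: x^T.
  by rewrite yJ linearD /= !linearZ.
rewrite xJ yJT mulmxBl mulmxBl mulmxDr -!scalemxAl -!scalemxAr.
move=> /matrixP/(_ 0 0); rewrite !mxE => eqz.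
have {}eqz : complex.Im z * ((x *m H *m x^T) 0 0 + (y *m H *m y^T) 0 0) = 0.
  by rewrite !mxE; lra.
move/eqP: eqz; rewrite mulf_eq0 => /orP[/eqP//|].
rewrite paddr_eq0 ?positive_definite_row_ge0// => /andP[/eqP xx /eqP yy].
case/eqP: v0; apply/matrixP => i j; rewrite mxE.
have /matrixP/(_ i j) := positive_definite_row_eq0 Hpd xx.
have /matrixP/(_ i j) := positive_definite_row_eq0 Hpd yy.
by rewrite !mxE; case: (v i j) => a b /= -> ->.
Qed.

(** The minimal polynomial of J has only real roots, so it is a product of real
    linear factors.  Let q be the product of these factors without repetition.
    A power of q vanishes at J, hence so does q, since J is self-adjoint; thus
    the minimal polynomial divides q, which has simple roots. *)
Lemma selfadjoint_diagonalizable (R : realType) (n : nat) (H J : 'M[R]_n.+1) :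
  positive_definite H -> J *m H = H *m J^T -> diagonalizable J.
Proof.
move=> Hpd JH.
have [rs prs] := closed_field_poly_normal
  (mxminpoly (map_mx (real_complex R) J)).
rewrite (monicP (mxminpoly_monic _)) scale1r in prs.
have rs_real z : z \in rs -> z = (complex.Re z)%:C%C.
  move=> zrs; have : root (mxminpoly (map_mx (real_complex R) J)) z.
    by rewrite prs root_prod_XsubC.
  rewrite -eigenvalue_root_min => /(selfadjoint_eigenvalue_real Hpd JH).
  by case: z {zrs} => a b /= ->.
pose ts := [seq complex.Re z | z <- rs].
have pts : mxminpoly J = \prod_(t <- ts) ('X - t%:P).
  apply: (map_poly_inj (real_complex R)).
  rewrite -mxminpoly_map prs rmorph_prod big_map /=.
  apply: eq_big_seq => z /rs_real {1}->.
  by rewrite rmorphB /= map_polyX map_polyC.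
apply/diagonalizableP; exists (undup ts); first exact: undup_uniq.
rewrite dvd_mxminpoly; apply/eqP.
apply: (@selfadjoint_nilpotent_eq0 _ _ _ _ _ (size ts) Hpd JH).
apply/eqP; rewrite -dvd_mxminpoly pts.
set q := (X in X ^+ _).
have dvd_lin t : t \in ts -> 'X - t%:P %| q.
  by move=> tts; rewrite dvdp_XsubCl root_prod_XsubC mem_undup.
clearbody q; elim: (ts) dvd_lin => [|t s IHs] dvd_lin.
  by rewrite big_nil dvd1p.
rewrite big_cons exprS dvdp_mul//; first by apply: dvd_lin; rewrite mem_head.
by apply: IHs => r rs'; apply: dvd_lin; rewrite in_cons rs' orbT.
Qed.

(** * Differential calculus of matrix-valued functions *)

Lemma near_eq_differentiable (R : numFieldType) (V W : normedModType R)
    (f g : V -> W) (x : V) :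
  (\near x, f x = g x) -> differentiable g x -> differentiable f x.
Proof.
move=> fg dg.
have fx : f \o shift x = cst (f x) + 'd g x +o_ 0 id.
  apply/eqaddoP => _/posnumP[e].
  have /eqaddoP/(_ _ (gt0 e)) dge := diff_locally dg.
  have fg0 : \forall h \near 0, f (h + x) = g (h + x).
    by move: (fg); rewrite (near_shift 0) subr0.
  apply: filterS2 fg0 dge => h fgh.
  by rewrite !fctE /= fgh (nbhs_singleton fg).
apply/diff_locallyP; rewrite (diff_unique _ fx); last exact: diff_continuous.
by split=> //; exact: diff_continuous.
Qed.

Section Differentiable.
Context {R : realFieldType} {V : normedModType R}.

Lemma differentiable_bigsum (I : Type) (r : seq I) (W : normedModType R)
    (F : I -> V -> W) (x : V) :
  (forall i, differentiable (F i) x) ->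
  differentiable (fun y => \sum_(i <- r) F i y) x.
Proof.
move=> dF; elim: r => [|i r IHr].
  under eq_fun do rewrite big_nil; exact: differentiable_cst.
under eq_fun do rewrite big_cons; exact: differentiableD.
Qed.

Lemma differentiable_bigprod (I : Type) (r : seq I)
    (F : I -> V -> R) (x : V) :
  (forall i, differentiable (F i) x) ->
  differentiable (fun y => \prod_(i <- r) F i y) x.
Proof.
move=> dF; elim: r => [|i r IHr].
  under eq_fun do rewrite big_nil; exact: differentiable_cst.
under eq_fun do rewrite big_cons; exact: differentiableM.
Qed.

Lemma differentiable_mx (m n : nat) (M : V -> 'M[R]_(m, n)) (x : V) :
  (forall i j, differentiable (fun y => M y i j) x) -> differentiable M x.
Proof.
move=> dM.
rewrite (_ : M = fun y => \sum_i \sum_j M y i j *: delta_mx i j); last first.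
  by apply/funext => y; exact: matrix_sum_delta.
apply: differentiable_bigsum => i; apply: differentiable_bigsum => j.
exact: differentiableZl.
Qed.

Lemma differentiable_det (n : nat) (M : V -> 'M[R]_n) (x : V) :
  (forall i j, differentiable (fun y => M y i j) x) ->
  differentiable (fun y => \det (M y)) x.
Proof.
move=> dM; rewrite /determinant; apply: differentiable_bigsum => s.
apply: differentiableM; first exact: differentiable_cst.
exact: differentiable_bigprod.
Qed.

Lemma differentiable_mulmx (m n p : nat) (M : V -> 'M[R]_(m, n))
    (N : V -> 'M[R]_(n, p)) (x : V) (i : 'I_m) (k : 'I_p) :
  (forall i j, differentiable (fun y => M y i j) x) ->
  (forall i j, differentiable (fun y => N y i j) x) ->
  differentiable (fun y => (M y *m N y) i k) x.
Proof.
move=> dM dN; under eq_fun do rewrite mxE.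
by apply: differentiable_bigsum => j; exact: differentiableM.
Qed.

Lemma differentiable_adj (n : nat) (M : V -> 'M[R]_n) (x : V) (i j : 'I_n) :
  (forall i j, differentiable (fun y => M y i j) x) ->
  differentiable (fun y => (\adj (M y)) i j) x.
Proof.
move=> dM; under eq_fun do rewrite mxE /cofactor.
apply: differentiableM; first exact: differentiable_cst.
by apply: differentiable_det => k l; under eq_fun do rewrite !mxE.
Qed.

Lemma near_unitmx (n : nat) (M : V -> 'M[R]_n) (x : V) :
  (forall i j, differentiable (fun y => M y i j) x) ->
  M x \in unitmx -> \near x, M x \in unitmx.
Proof.
move=> dM; rewrite unitmxE unitfE => Mx0.
have /differentiable_continuous cdet := differentiable_det dM.
near=> y; rewrite unitmxE unitfE; near: y.
apply: (cdet [set r : R | r != 0]).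
exact: open_nbhs_nbhs.
Unshelve. all: by end_near. Qed.

(** M is invertible near x, and there Cramer's rule writes the solution as a
    rational function of the entries of M and b. *)
Lemma differentiable_linear_solution (n : nat) (M : V -> 'M[R]_n)
    (b f : V -> 'cV[R]_n) (x : V) :
  (forall i j, differentiable (fun y => M y i j) x) ->
  (forall i j, differentiable (fun y => b y i j) x) ->
  M x \in unitmx ->
  (forall y, M y \in unitmx -> M y *m f y = b y) ->
  differentiable f x.
Proof.
move=> dM db Mx Mf.
apply: (@near_eq_differentiable _ _ _ _
    (fun y => (\det (M y))^-1 *: (\adj (M y) *m b y))).
  near=> y; have My : M y \in unitmx by near: y; exact: near_unitmx.
  rewrite -(Mf y My) mulmxA mul_adj_mx mul_scalar_mx scalerA.
  by rewrite mulVr -?unitmxE// scale1r.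
apply: differentiable_mx => i j; under eq_fun do rewrite mxE.
apply: differentiableM.
  apply: differentiableV; first exact: differentiable_det.
  by rewrite -unitfE -unitmxE.
by apply: differentiable_mulmx => // k l; exact: differentiable_adj.
Unshelve. all: by end_near. Qed.

Lemma is_derive_mx (m n : nat) (M : V -> 'M[R]_(m, n)) (dM : 'M[R]_(m, n))
    (x v : V) :
  is_derive x v M dM <->
  forall i j, is_derive x v (fun y => M y i j) (dM i j).
Proof.
split=> [[/[dup] dMv /derivable_mxP dMij dME] i j|dMij].
  by apply: DeriveDef => //; rewrite -dME derive_mx// mxE.
have dMv : derivable M x v by apply/derivable_mxP => i j; case: (dMij i j).
apply: DeriveDef => //; rewrite derive_mx//; apply/matrixP => i j; rewrite mxE.
by case: (dMij i j).
Qed.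

Lemma is_derive_bigsum (n : nat) (F : 'I_n -> V -> R) (dF : 'I_n -> R)
    (x v : V) :
  (forall i, is_derive x v (F i) (dF i)) ->
  is_derive x v (fun y => \sum_i F i y) (\sum_i dF i).
Proof.
move=> dFi; rewrite (_ : (fun y => _) = \sum_i F i); last first.
  by apply/funext => y; rewrite fct_sumE.
exact: is_derive_sum.
Qed.

Lemma is_derive_mulmx (m n p : nat) (M : V -> 'M[R]_(m, n))
    (N : V -> 'M[R]_(n, p)) (dM : 'M[R]_(m, n)) (dN : 'M[R]_(n, p)) (x v : V) :
  is_derive x v M dM -> is_derive x v N dN ->
  is_derive x v (fun y => M y *m N y) (dM *m N x + M x *m dN).
Proof.
move=> /is_derive_mx dMij /is_derive_mx dNij; apply/is_derive_mx => i k.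
under eq_fun do rewrite mxE.
rewrite !mxE -big_split /=; apply: is_derive_bigsum => j.
apply: (is_derive_eq (is_deriveM (dMij i j) (dNij j k))).
by rewrite /GRing.scale /= addrC; congr (_ + _); rewrite mulrC.
Qed.

End Differentiable.

(** * The Galerkin matrices and the flux *)

Section GalerkinMatrix.
Context {R : realType} {d : measure_display} {Omega : measurableType d}.
Context {Pr : probability Omega R} {N : nat} {xi : {RV Pr >-> N.-tuple R}}.
Context {n : nat} {psi : 'I_n.+1 -> N.-tuple R -> R}.
Local Notation B := (galerkinB xi psi).

Lemma galerkinB_trmx b c : (B b c)^T = B b c.
Proof.
apply/matrixP => j k; rewrite !mxE.
apply: eq_bigr => h _; apply: eq_bigr => i _.
by under eq_fun do rewrite mulrAC.
Qed.

Lemma galerkinBC b c : B b c = B c b.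
Proof.
apply/matrixP => j k; rewrite !mxE exchange_big /=.
apply: eq_bigr => h _; apply: eq_bigr => i _.
under eq_fun do rewrite (mulrC (psi i _)).
by rewrite mulrAC.
Qed.

(** The index of the summed vector and that of the second argument of B play
    symmetric roles in the fourth moments. *)
Lemma galerkinB_mulmxC b c u : B b c *m u = B b u *m c.
Proof.
apply/matrixP => j l; rewrite (ord1 l) !mxE.
have expand (c' u' : 'cV[R]_n.+1) : \sum_k B b c' j k * u' k 0 =
    \sum_k \sum_i \sum_h
      mean xi (fun y => psi h y * psi i y * psi j y * psi k y)
      * b h 0 * c' i 0 * u' k 0.
  apply: eq_bigr => k _; rewrite mxE exchange_big mulr_suml.
  by apply: eq_bigr => i _; rewrite mulr_suml.
rewrite !expand exchange_big /=; apply: eq_bigr => i _; apply: eq_bigr => k _.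
apply: eq_bigr => h _; rewrite [RHS]mulrAC; congr (mean _ _ * _ * _ * _).
by apply/funext => y; ring.
Qed.

Lemma galerkinBNr b c : B b (- c) = - B b c.
Proof.
apply/matrixP => j k; rewrite !mxE -sumrN; apply: eq_bigr => h _ /=.
by rewrite -sumrN; apply: eq_bigr => i _ /=; rewrite mxE mulrN.
Qed.

Lemma is_derive_galerkinB (V : normedModType R) (b c : V -> 'cV[R]_n.+1)
    (db dc : 'cV[R]_n.+1) (x v : V) :
  is_derive x v b db -> is_derive x v c dc ->
  is_derive x v (fun y => B (b y) (c y)) (B db (c x) + B (b x) dc).
Proof.
move=> /is_derive_mx dbi /is_derive_mx dci; apply/is_derive_mx => j k.
under eq_fun do rewrite mxE.
rewrite !mxE -big_split /=; apply: is_derive_bigsum => h.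
rewrite -big_split /=; apply: is_derive_bigsum => i.
set m := mean _ _.
have dmb : is_derive x v (fun y => m * b y h 0) (m * db h 0).
  exact: (is_deriveZ m (dbi h 0)).
apply: (is_derive_eq (is_deriveM dmb (dci i 0))).
by rewrite /GRing.scale /= addrC; congr (_ + _); rewrite mulrC.
Qed.

Lemma differentiable_galerkinB (V : normedModType R)
    (b c : V -> 'cV[R]_n.+1) (x : V) (j k : 'I_n.+1) :
  (forall i, differentiable (fun y => b y i 0) x) ->
  (forall i, differentiable (fun y => c y i 0) x) ->
  differentiable (fun y => B (b y) (c y) j k) x.
Proof.
move=> db dc; under eq_fun do rewrite mxE.
apply: differentiable_bigsum => h; apply: differentiable_bigsum => i.
by apply: differentiableM => //; exact: differentiableM.
Qed.

Context {a : R} {u : 'cV[R]_n.+1} {f : 'cV[R]_n.+1 -> 'cV[R]_n.+1}.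
Context (hf : galerkin_flux xi psi a u f).
Local Notation A := (buckley_leverett_matrix xi psi a).
Local Notation e := (e1 R n).

Lemma differentiable_buckley_leverett_matrix (S : 'cV[R]_n.+1) (j k : 'I_n.+1) :
  differentiable (fun s => A s j k) S.
Proof.
have did i : differentiable (fun s : 'cV[R]_n.+1 => s i 0) S.
  exact: differentiable_coord.
have dsub i : differentiable (fun s : 'cV[R]_n.+1 => (e - s) i 0) S.
  under eq_fun do rewrite mxE [X in _ + X]mxE.
  apply: differentiableB => //; exact: differentiable_cst.
under eq_fun do rewrite mxE [X in _ + X]mxE.
apply: differentiableD; first exact: differentiable_galerkinB.
apply: differentiableM; first exact: differentiable_cst.
exact: differentiable_galerkinB.
Qed.

Lemma galerkin_flux_differentiable (S : 'cV[R]_n.+1) :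
  A S \in unitmx -> differentiable f S.
Proof.
move=> AS; apply: (differentiable_linear_solution _ _ AS hf) => i j.
  exact: differentiable_buckley_leverett_matrix.
apply: differentiable_mulmx => k l; last exact: differentiable_cst.
by apply: differentiable_galerkinB => m; exact: differentiable_coord.
Qed.

(** The two terms of the product rule agree because B is symmetric in its
    arguments. *)
Lemma is_derive_galerkinB_diag (S v : 'cV[R]_n.+1) :
  is_derive S v (fun s => B s s) (2 *: B S v).
Proof.
apply: (is_derive_eq
  (is_derive_galerkinB (is_derive_id S v) (is_derive_id S v))).
by rewrite galerkinBC -mulr2n scaler_nat.
Qed.

Lemma is_derive_buckley_leverett_matrix (S v : 'cV[R]_n.+1) :
  is_derive S v A (2 *: (B S v - a *: B (e - S) v)).
Proof.
have de : is_derive S v (fun s => e - s) (- v).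
  by rewrite -(sub0r v); exact: is_deriveB.
have dB := is_deriveZ a (is_derive_galerkinB de de).
apply: (is_derive_eq (is_deriveD (is_derive_galerkinB_diag S v) dB)).
rewrite (galerkinBC (- v)) galerkinBNr -mulr2n -[(- _) *+ 2]scaler_nat scalerBr.
by rewrite !scalerN !scalerA mulrC.
Qed.

(** Column k of both sides comes from the derivative of A(s) f(s) = B(s, s) u at
    S in the direction of the k-th basis vector v; the exchange rule
    [galerkinB_mulmxC] turns B(S, v) w into B(S, w) v for w = u and w = f S.
    The right-hand side is visibly symmetric, which is the point of the
    lemma. *)
Lemma galerkin_flux_jacobian (S : 'cV[R]_n.+1) :
  A S \in unitmx ->
  A S *m flux_jacobian f S =
    2 *: (B S u - B S (f S) + a *: B (e - S) (f S)).
Proof.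
move=> AS; have df := galerkin_flux_differentiable AS.
have dA := differentiable_buckley_leverett_matrix S.
(* Transposition turns the row-wise criterion into a column-wise one. *)
apply/trmx_inj/row_matrixP => k; rewrite -!tr_col; congr trmx.
rewrite !colE -mulmxA -colE; set v := delta_mx k 0.
have -> : col k (flux_jacobian f S) = 'D_v f S.
  rewrite derive_mx; last exact: diff_derivable.
  by apply/matrixP => i j; rewrite (ord1 j) !mxE.
have dfv : is_derive S v f ('D_v f S) by exact/derivableP/diff_derivable.
have lhs := is_derive_mulmx (is_derive_buckley_leverett_matrix S v) dfv.
have rhs := is_derive_mulmx (is_derive_galerkinB_diag S v)
  (is_derive_cst u S v).
have : \forall s \near S, A s *m f s = B s s *m u.
  by apply: filterS (near_unitmx dA AS) => s; exact: hf.
move=> /near_eq_derive-/(_ v).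
rewrite (@derive_val _ _ _ _ _ _ _ lhs) (@derive_val _ _ _ _ _ _ _ rhs).
rewrite mulmx0 addr0 => /(canRL (addKr _)) ->; rewrite addrC.
rewrite -!scalemxAl -scalerBr; congr (_ *: _).
rewrite !mulmxDl !mulNmx -!scalemxAl !(galerkinB_mulmxC _ v).
by rewrite opprD opprK addrA.
Qed.

End GalerkinMatrix.

Unset Implicit Arguments.

Theorem proposition2 (R : realType) (d : measure_display)
    (Omega : measurableType d) (Pr : probability Omega R)
    (N : nat) (xi : {RV Pr >-> N.-tuple R})
    (n : nat) (psi : 'I_n.+1 -> N.-tuple R -> R)
    (hpsi : multiwavelet_system xi psi)
    (a : R) (ha : 0 < a) (u : 'cV[R]_n.+1)
    (f : 'cV[R]_n.+1 -> 'cV[R]_n.+1) (hf : galerkin_flux xi psi a u f)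
    (S : 'cV[R]_n.+1)
    (hS : positive_definite (buckley_leverett_matrix xi psi a S)) :
  hyperbolic_at f S.
Proof.
have AS := positive_definite_unitmx hS.
split; first exact: (galerkin_flux_differentiable hf).
(* The form on row vectors is given by A^-1: with J = A^-1 G, the product
   J A^-1 = A^-1 G A^-1 is symmetric. *)
apply: (selfadjoint_diagonalizable (positive_definite_invmx hS)).
have [Asym _] := hS.
set A := buckley_leverett_matrix xi psi a S in AS Asym *.
have Gsym : (A *m flux_jacobian f S)^T = A *m flux_jacobian f S.
  rewrite (galerkin_flux_jacobian hf AS) [LHS]linearZ; congr (_ *: _).
  by rewrite linearD linearB linearZ /= !galerkinB_trmx.
have -> : (flux_jacobian f S)^T = A *m flux_jacobian f S *m invmx A.
  rewrite -[in LHS](mulKmx AS (flux_jacobian f S)) trmx_mul Gsym.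
  by rewrite trmx_inv Asym.
by rewrite -mulmxA mulKmx.
Qed.
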